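(* Let $X$ and $Y$ be normed vector spaces over $\mathbb{R}$ with norms $\|\cdot\|_X$ and $\|\cdot\|_Y$, let $\Omega\subseteq X$ be open, and let $f:\Omega\to Y$ be a function. If $f$ is Gâteaux differentiable at $x\in\Omega$ with Gâteaux derivative $d f(x)$, then $f$ is specularly Gâteaux differentiable at $x$ and its specular Gâteaux derivative $\widehat{d} f(x)$ satisfies $\widehat{d} f(x)=d f(x)$.
   Context: $\mathcal{L}(X;Y)$ is the space of continuous linear operators $X\to Y$. The product norm is $\|(x,y)\|_{X\times Y}:=(\|x\|_X^2+\|y\|_Y^2)^{1/2}$. Directional derivative: $\partial_v f(x):=\lim_{h\to 0}\frac{f(x+hv)-f(x)}{h}$ (limit over nonzero real $h$, in $Y$), when it exists. $f$ is Gâteaux differentiable at $x$ if $\partial_v f(x)$ exists for all $v\in X$ and there is $\ell\in\mathcal{L}(X;Y)$ with $\ell(v)=\partial_v f(x)$ for all $v\in X$; then $d f(x):=\ell$. Specular directional derivative: for $v\in X\setminus\{0\}$, $$\partial_v^{\wedge}f(x):=\lim_{h\searrow 0}\left[\frac{f(x+hv)-f(x)}{h}\cdot\frac{\|U\|_{X\times Y}}{\|U\|_{X\times Y}+\|V\|_{X\times Y}}+\frac{f(x)-f(x-hv)}{h}\cdot\frac{\|V\|_{X\times Y}}{\|U\|_{X\times Y}+\|V\|_{X\times Y}}\right]$$ (limit over $h>0$, in $Y$), when it exists, where $U:=(hv,f(x)-f(x-hv))$ and $V:=(hv,f(x+hv)-f(x))$ for sufficiently small $h>0$; and $\partial_0^{\wedge}f(x):=0$.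 $f$ is specularly Gâteaux differentiable at $x$ if $\partial_v^{\wedge}f(x)$ exists for all $v\in X$ and there is $\ell\in\mathcal{L}(X;Y)$ with $\ell(v)=\partial_v^{\wedge}f(x)$ for all $v\in X$; then $\widehat{d} f(x):=\ell$. *)

(* Defs.v *)
From HB Require Import structures.
From mathcomp Require Import all_boot all_order all_algebra.
From mathcomp Require Import all_classical all_reals all_analysis.

Set Implicit Arguments.
Unset Strict Implicit.
Unset Printing Implicit Defensive.

Import Order.TTheory GRing.Theory Num.Theory.
Import numFieldNormedType.Exports.

Local Open Scope classical_set_scope.
Local Open Scope ring_scope.

Section SpecularGateaux.
Context {R : realType} {X Y : normedModType R}.

(* The library norm on X * Y is the maximum norm, not this one. *)
Definition prod_norm (p : X * Y) : R :=
  Num.sqrt (`|p.1| ^+ 2 + `|p.2| ^+ 2).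

Definition continuous_linear : set (X -> Y) :=
  [set l | linear l /\ continuous l].

Implicit Types (f : X -> Y) (x v : X) (l : X -> Y).

Definition is_gateaux_derivative f x l : Prop :=
  [/\ forall v, derivable f x v, continuous_linear l
    & forall v, l v = 'D_v f x].

Definition gateaux_differentiable f x : Prop :=
  exists l, is_gateaux_derivative f x l.

(* The zero map when f is not Gateaux differentiable at x; otherwise the
   derivative, which is unique because its values are prescribed. *)
Definition gateaux_derivative f x : X -> Y :=
  xget (fun=> 0) [set l | is_gateaux_derivative f x l].

Definition specular_quotient f x v (h : R) : Y :=
  let U := (h *: v, f x - f (x - h *: v)) in
  let V := (h *: v, f (x + h *: v) - f x) in
  (prod_norm U / (prod_norm U + prod_norm V)) *:
    (h^-1 *: (f (x + h *: v) - f x)) +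
  (prod_norm V / (prod_norm U + prod_norm V)) *:
    (h^-1 *: (f x - f (x - h *: v))).

(* In the direction 0 the specular derivative exists by convention. *)
Definition specular_derivable f x v : Prop :=
  v != 0 -> cvg (specular_quotient f x v h @[h --> (0 : R)^'+]).

Definition specular_derive f x v : Y :=
  if v == 0 then 0 else lim (specular_quotient f x v h @[h --> (0 : R)^'+]).

Definition is_specular_gateaux_derivative f x l : Prop :=
  [/\ forall v, specular_derivable f x v, continuous_linear l
    & forall v, l v = specular_derive f x v].

Definition specular_gateaux_differentiable f x : Prop :=
  exists l, is_specular_gateaux_derivative f x l.

Definition specular_gateaux_derivative f x : X -> Y :=
  xget (fun=> 0) [set l | is_specular_gateaux_derivative f x l].

(* A function given only on Omega is extended by 0.  When Omega is open, the
   notions above do not depend on the extension at points of Omega, since they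
   only involve the values of f near x along each line through x. *)
Definition extend (Omega : set X) (f : Omega -> Y) : X -> Y := 'valL_0 f.

End SpecularGateaux.

(* Main.v *)
Require Import Defs.
From HB Require Import structures.
From mathcomp Require Import all_boot all_order all_algebra.
From mathcomp Require Import all_classical all_reals all_analysis.

Set Implicit Arguments.
Unset Strict Implicit.
Unset Printing Implicit Defensive.

Import Order.TTheory GRing.Theory Num.Theory.
Import numFieldNormedType.Exports.

Local Open Scope classical_set_scope.
Local Open Scope ring_scope.

(** The specular quotient in a direction [v != 0] is a convex combination of
    the forward difference quotient [(f (x + h v) - f x) / h] and the backward
    one [(f x - f (x - h v)) / h]: its two weights are nonnegative and, because
    [h v != 0] forces the norms of U and V to be positive, they add up to 1.
    The two-sided limit defining ['D_v f x] makes both quotients converge to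
    ['D_v f x] (the backward one is the forward one read at [- h]).  Balls are
    convex, so the combination converges to the same limit whether or not the
    weights themselves converge ([cvg_convex_combination], applied in
    [cvg_specular_quotient]).  In the direction 0
    the convention for the specular derivative agrees with the linearity of the
    Gateaux derivative.  Hence every Gateaux derivative is a specular one, and
    since either kind is determined by its values, the two selected maps
    coincide. *)

(** The weights are only constrained pointwise: once both functions lie in a
    ball around the limit, so does any convex combination of them. *)
Lemma cvg_convex_combination (R : realType) (Y : normedModType R) (T : Type)
    (F : set_system T) (FF : Filter F) (a b : T -> R) (g k : T -> Y) (l : Y) :
  (\forall t \near F, [/\ 0 <= a t, 0 <= b t & a t + b t = 1]) ->
  g t @[t --> F] --> l -> k t @[t --> F] --> l ->
  a t *: g t + b t *: k t @[t --> F] --> l.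
Proof.
move=> ab /cvgrPdist_le gl /cvgrPdist_le kl.
apply/cvgrPdist_le => e e0.
have gle := gl e e0; have kle := kl e e0.
near=> t.
have [a0 b0 ab1] : [/\ 0 <= a t, 0 <= b t & a t + b t = 1] by near: t.
have gt : `|l - g t| <= e by near: t.
have kt : `|l - k t| <= e by near: t.
have -> : l - (a t *: g t + b t *: k t) =
    a t *: (l - g t) + b t *: (l - k t).
  by rewrite !scalerBr addrACA -scalerDl ab1 scale1r opprD.
rewrite (le_trans (ler_normD _ _))// !normrZ !ger0_norm//.
rewrite -[leRHS]mul1r -ab1 mulrDl.
by apply: lerD; exact: ler_wpM2l.
Unshelve. all: by end_near. Qed.

Lemma prod_norm_ge0 (R : realType) (X Y : normedModType R) (p : X * Y) :
  0 <= prod_norm p.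
Proof. exact: sqrtr_ge0. Qed.

Lemma prod_norm_gt0 (R : realType) (X Y : normedModType R) (p : X * Y) :
  p.1 != 0 -> 0 < prod_norm p.
Proof.
move=> p0; rewrite sqrtr_gt0 ltr_wpDr ?exprn_ge0//.
by rewrite exprn_gt0 ?normr_gt0.
Qed.

Section SpecularDerivative.
Context {R : realType} {X Y : normedModType R}.
Implicit Types (f : X -> Y) (x v : X).

Lemma cvg_forward_quotient f x v : derivable f x v ->
  h^-1 *: (f (x + h *: v) - f x) @[h --> (0 : R)^'+] --> 'D_v f x.
Proof.
move=> fxv.
have /cvg_dnbhs_at_right : h^-1 *: ((f \o shift x) (h *: v) - f x)
    @[h --> (0 : R)^'] --> 'D_v f x by exact: fxv.
by apply: cvg_trans; apply: near_eq_cvg; near=> h; rewrite /= [_ + x]addrC.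
Unshelve. all: by end_near. Qed.

(** The left limit of the forward quotient at 0 becomes, after [h] is replaced
    by [- h], the right limit of the backward quotient. *)
Lemma cvg_backward_quotient f x v : derivable f x v ->
  h^-1 *: (f x - f (x - h *: v)) @[h --> (0 : R)^'+] --> 'D_v f x.
Proof.
move=> fxv.
have /cvg_dnbhs_at_left/cvg_at_leftNP : h^-1 *: ((f \o shift x) (h *: v) - f x)
    @[h --> (0 : R)^'] --> 'D_v f x by exact: fxv.
rewrite oppr0; apply: cvg_trans; apply: near_eq_cvg; near=> h.
by rewrite /= invrN scaleNr -scalerN opprB scaleNr [- _ + x]addrC.
Unshelve. all: by end_near. Qed.

Lemma cvg_specular_quotient f x v : v != 0 -> derivable f x v ->
  specular_quotient f x v h @[h --> (0 : R)^'+] --> 'D_v f x.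
Proof.
move=> v0 fxv; apply: cvg_convex_combination.
- near=> h.
  set U := (h *: v, f x - f (x - h *: v)).
  set V := (h *: v, f (x + h *: v) - f x).
  have hv0 : h *: v != 0.
    have h0 : 0 < h by near: h; exact: nbhs_right_gt.
    by rewrite scaler_eq0 negb_or v0 andbT gt_eqF.
  have UV : 0 < prod_norm U + prod_norm V.
    by rewrite addr_gt0 ?prod_norm_gt0.
  by split; rewrite ?divr_ge0 ?prod_norm_ge0// ?(ltW UV)// -mulrDl divff ?gt_eqF.
- exact: cvg_forward_quotient.
- exact: cvg_backward_quotient.
Unshelve. all: by end_near. Qed.

Lemma gateaux_is_specular_gateaux_derivative f x (l : X -> Y) :
  is_gateaux_derivative f x l -> is_specular_gateaux_derivative f x l.
Proof.
move=> [fx [linl contl] lE]; split => //.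
- move=> v v0; apply/cvg_ex; exists ('D_v f x).
  exact: cvg_specular_quotient.
- move=> v; rewrite /specular_derive; case: eqVneq => [->|v0].
    by have := linl (-1) 0 0; rewrite scaler0 addr0 scaleN1r addNr.
  by rewrite lE; apply/esym/cvg_lim => //; exact: cvg_specular_quotient.
Qed.

Lemma gateaux_derivativeE f x (l : X -> Y) :
  is_gateaux_derivative f x l -> gateaux_derivative f x = l.
Proof.
move=> fl; apply/funext => v.
have [_ _ ->] : is_gateaux_derivative f x (gateaux_derivative f x).
  by apply: (xgetPex (fun=> 0)); exists l.
by case: fl => _ _ ->.
Qed.

Lemma specular_gateaux_derivativeE f x (l : X -> Y) :
  is_specular_gateaux_derivative f x l -> specular_gateaux_derivative f x = l.
Proof.
move=> fl; apply/funext => v.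
have [_ _ ->] :
    is_specular_gateaux_derivative f x (specular_gateaux_derivative f x).
  by apply: (xgetPex (fun=> 0)); exists l.
by case: fl => _ _ ->.
Qed.

End SpecularDerivative.

Theorem proposition4p2 (R : realType) (X Y : normedModType R)
    (Omega : set X) (hOmega : open Omega) (f : Omega -> Y) (x : X)
    (hx : Omega x)
    (hf : gateaux_differentiable (extend f) x) :
  specular_gateaux_differentiable (extend f) x /\
  specular_gateaux_derivative (extend f) x =
    gateaux_derivative (extend f) x.
Proof.
case: hf => l fl; have sfl := gateaux_is_specular_gateaux_derivative fl.
split; first by exists l.
by rewrite (gateaux_derivativeE fl) (specular_gateaux_derivativeE sfl).
Qed.
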